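(* Let $\Delta t>0$ and consider the CN-SM scheme $$\frac{u^{n+1}-u^{n}}{\Delta t}+\mathcal{A}\frac{u^{n+1}+u^{n}}{2}+ g\left(\eta^{n+\frac12}\overline{u}^{n+\frac12}\right)=0,$$ $$\frac{\ln V^{n+\frac12}-\ln V^{n-\frac12}}{\Delta t}=-\frac{\mathcal{K}(u^n)}{E(u^n)},\qquad \eta^{n+\frac12}=\chi(V^{n+\frac12}).$$ Given $V^{n-\frac12}>0$, we have $V^{n+\frac12}>0$, and the scheme is unconditionally energy stable (i.e. for every time step $\Delta t>0$) in the sense that $$V^{n+\frac12}-V^{n-\frac12}=\left(e^{-\frac{\mathcal{K}(u^n)}{E(u^n)}\Delta t}-1\right)V^{n-\frac12}\leq0.$$
   Context: The dissipative system is $\frac{\partial u}{\partial t}+\mathcal{A}u+g(u)=0$, where $u$ is a scalar or vector function, $\mathcal{A}$ is a positive definite operator and $g$ is a semi-linear or quasi-linear operator with lower-order derivatives. It satisfies the energy law $\frac{dE_{tot}(u)}{dt}=-\mathcal{K}(u)$, where $E_{tot}$ is a real-valued free energy and $\mathcal{K}(u)\ge 0$ for all $u$. The energy is assumed to have a known lower bound: there is a constant $C_0>0$ such that $E(u):=E_{tot}(u)+C_0>0$ for all $u$. The scheme discretizes the auxiliary variable $V(t)=E(u(t))$ on the staggered time mesh $t^{n\pm\frac12}$, where $t^n=n\Delta t$; $u^n$ approximates $u(t^n)$ and $V^{n+\frac12}$ approximates $V(t^{n+\frac12})$. Here $\overline{u}^{n+\frac12}$ is any explicit $O(\Delta t^2)$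 approximation of $u(t^{n+\frac12})$ (e.g. $\frac32u^n-\frac12u^{n-1}$ for $n\ge1$), and $\chi$ is a functional of $V$ that equals $1$ at the continuous level (e.g. $\chi(V)=V/E(u)$, discretized as $\chi(V^{n+\frac12})=V^{n+\frac12}/E(\overline{u}^{n+\frac12})$). *)

(* Defs.v *)
From HB Require Import structures.
From mathcomp Require Import all_boot all_order all_algebra.
From mathcomp Require Import sesquilinear.
From mathcomp Require Import all_classical all_reals all_analysis.

Set Implicit Arguments.
Unset Strict Implicit.
Unset Printing Implicit Defensive.

Import Order.TTheory GRing.Theory Num.Theory.
Import numFieldNormedType.Exports.

Local Open Scope classical_set_scope.
Local Open Scope ring_scope.

(** [H] is the space of (scalar or vector) functions of the space variable,
    and a time-dependent [u] is a map from the time axis to [H].  The operators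
    and functionals are total functions on [H], but they are only meaningful on
    the set [dom] of admissible functions (regularity, boundary conditions):
    every "for all u" ranges over [dom]. *)

(** Smooth solutions on the time set [J] of [u' + A u + g u = 0].  Smoothness is
    required on a neighbourhood of each point of [J], so that end points of a
    closed [J] need no one-sided derivatives. *)
Definition is_solution (R : realType) (H : normedModType R) (dom : set H)
    (A g : H -> H) (J : set R) (u : R -> H) : Prop :=
  forall t : R, J t ->
    [/\ dom (u t),
        forall m : nat, \forall s \near t, derivable (derive1n m u) s 1
      & derive1 u t + A (u t) + g (u t) = 0].

(** [opg] is an arbitrary nonlinear operator on [dom]; semi-linear and
    quasi-linear operators of lower order than [opA] are instances. *)
Record dissipative_system (R : realType) (H : normedModType R) := {
  inner : {dot H for idfun};
  norm_inner : forall u : H, `|u| ^+ 2 = inner u u;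
  dom : set H;
  dom0 : dom 0;
  domP : forall (a : R) (u v : H), dom u -> dom v -> dom (a *: u + v);
  opA : H -> H;
  opA_linear : forall (a : R) (u v : H), dom u -> dom v ->
    opA (a *: u + v) = a *: opA u + opA v;
  opA_posdef : forall u : H, dom u -> u != 0 -> 0 < inner (opA u) u;
  opg : H -> H;
  Etot : H -> R;
  dissip : H -> R;
  dissip_ge0 : forall u : H, dom u -> 0 <= dissip u;
  energy_law : forall (a b : R) (u : R -> H),
    is_solution dom opA opg `]a, b[ u ->
    forall t : R, a < t < b ->
      derivable (Etot \o u) t 1 /\ derive1 (Etot \o u) t = - dissip (u t);
  C0 : R;
  C0_gt0 : 0 < C0;
  Etot_C0_gt0 : forall u : H, dom u -> 0 < Etot u + C0
}.

Definition energy (R : realType) (H : normedModType R)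
  (S : dissipative_system H) (u : H) : R := Etot S u + C0 S.

(** [chi V u] depends on the auxiliary variable [V] and on the state; at the
    continuous level [V = energy S u].  Example: [V / energy S u]. *)
Definition consistent_chi (R : realType) (H : normedModType R)
    (S : dissipative_system H) (chi : R -> H -> R) : Prop :=
  forall u : H, dom S u -> chi (energy S u) u = 1.

(** A rule [ubar] sends the time step, the index [n] and the discrete values
    [u^0, u^1, ...] to the approximation of [u(t^{n+1/2})].  It is explicit when
    only [u^0, ..., u^n] are used. *)
Definition explicit_rule (R : realType) (H : normedModType R)
    (ubar : R -> nat -> (nat -> H) -> H) : Prop :=
  forall (dt : R) (n : nat) (u v : nat -> H),
    (forall k : nat, (k <= n)%N -> u k = v k) -> ubar dt n u = ubar dt n v.

(** Second order: fed with the exact values [u(t^k)] of a smooth solution on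
    [0, T], the rule has an error O(dt^2), uniformly in the time levels. *)
Definition second_order_rule (R : realType) (H : normedModType R)
    (S : dissipative_system H) (ubar : R -> nat -> (nat -> H) -> H) : Prop :=
  forall (T : R) (u : R -> H), 0 < T ->
    is_solution (dom S) (opA S) (opg S) `[0, T] u ->
    exists C : R, \forall dt \near 0^'+, forall n : nat,
      n.+1%:R * dt <= T ->
      `|ubar dt n (fun k => u (k%:R * dt)) - u ((n%:R + 2^-1) * dt)|
        <= C * dt ^+ 2.

(** [l] is the logarithm of [x], as a partial function.  The total function
    [ln] takes an arbitrary value on [x <= 0], so that an equation between
    values of [ln] could have spurious nonpositive solutions. *)
Definition is_ln (R : realType) (x l : R) : Prop := expR l = x.

Lemma is_lnE (R : realType) (x l : R) : is_ln x l <-> 0 < x /\ ln x = l.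
Proof.
split=> [<-|[x0 <-]]; first by rewrite expR_gt0 expRK.
by apply: lnK; rewrite posrE.
Qed.

(** One step of the scheme, from level [n] to level [n+1].  The staggered
    variable is stored as [Vh n] for V^{n-1/2}; thus [Vh n.+1] is V^{n+1/2}. *)
Definition cn_sm_step (R : realType) (H : normedModType R)
    (S : dissipative_system H) (chi : R -> H -> R)
    (ubar : R -> nat -> (nat -> H) -> H) (dt : R)
    (u : nat -> H) (Vh : nat -> R) (n : nat) : Prop :=
  let un12 := ubar dt n u in
  let eta := chi (Vh n.+1) un12 in
  [/\ [/\ dom S (u n), dom S (u n.+1) & dom S un12],
      dt^-1 *: (u n.+1 - u n) + opA S (2^-1 *: (u n.+1 + u n))
        + opg S (eta *: un12) = 0
    & exists lp lm : R,
        [/\ is_ln (Vh n.+1) lp, is_ln (Vh n) lm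
          & (lp - lm) / dt = - (dissip S (u n) / energy S (u n))]].

(* Main.v *)
Require Import Defs.
From HB Require Import structures.
From mathcomp Require Import all_boot all_order all_algebra.
From mathcomp Require Import all_classical all_reals all_analysis.

Import Order.TTheory GRing.Theory Num.Theory.
Import numFieldNormedType.Exports.

Local Open Scope ring_scope.

(** The scheme updates [ln V] rather than [V], so its second equation solves in
    closed form: V^{n+1/2} is V^{n-1/2} times the decay factor
    exp(- dt K(u^n) / E(u^n)).  An exponential is positive whatever [dt] is,
    hence positivity is inherited with no restriction on the time step; and the
    exponent is nonpositive, because K >= 0 on admissible states and E > 0 by the
    choice of the lower bound C0, hence the factor is at most 1 and the modified
    energy cannot increase. *)

(** This quotient is the exponential decay rate of the modified energy, so its
    sign is what makes the scheme dissipative. *)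
Lemma decay_rate_ge0 (R : realType) (H : normedModType R)
    (S : dissipative_system H) (v : H) :
  dom S v -> 0 <= dissip S v / energy S v.
Proof.
by move=> vS; rewrite divr_ge0 ?dissip_ge0// ltW// /energy Etot_C0_gt0.
Qed.

(** A logarithmic difference quotient equal to [r] is an exact exponential step
    of rate [r], with no truncation error. *)
Lemma log_step_expR (R : realType) (dt r x y lx ly : R) :
  dt != 0 -> is_ln x lx -> is_ln y ly -> (ly - lx) / dt = r ->
  y = expR (r * dt) * x.
Proof. by move=> dt0 <- <- <-; rewrite divfK// -expRD subrK. Qed.

Theorem theorem2p1 (R : realType) (H : normedModType R)
  (S : dissipative_system H)
  (chi : R -> H -> R) (chi_consistent : consistent_chi S chi)
  (ubar : R -> nat -> (nat -> H) -> H)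
  (ubar_explicit : explicit_rule ubar)
  (ubar_second_order : second_order_rule S ubar)
  (dt : R) (dt_gt0 : 0 < dt)
  (u : nat -> H) (Vh : nat -> R) (n : nat)
  (scheme : cn_sm_step S chi ubar dt u Vh n)
  (Vn_gt0 : 0 < Vh n) :
  [/\ 0 < Vh n.+1,
      Vh n.+1 - Vh n =
        (expR (- (dissip S (u n) / energy S (u n)) * dt) - 1) * Vh n
    & (expR (- (dissip S (u n) / energy S (u n)) * dt) - 1) * Vh n <= 0].
Proof.
case: scheme => -[un_dom _ _] _ [lp [lm [Vp_ln Vm_ln log_step]]].
have VE := log_step_expR _ _ _ _ _ _ _ (lt0r_neq0 dt_gt0) Vm_ln Vp_ln log_step.
split.
- by rewrite VE mulr_gt0 ?expR_gt0.
- by rewrite VE mulrBl mul1r.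
- rewrite pmulr_lle0// subr_le0 -expR0 ler_expR mulNr oppr_le0.
  by rewrite mulr_ge0 ?decay_rate_ge0 // ltW.
Qed.
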